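(* Let $(X,\operatorname{dist})$ be a compact metric space, $f\colon X\to X$ a homeomorphism and $D\geq 0$ an integer. If $f$ is dw-expansive with central dimension $D$, then $f$ is partially expansive with central dimension $D$.
   Context: Let $\tau$ be the topology of $X$. For $\mathcal{U}\subset\tau$, write $\operatorname{ord}\mathcal{U}\leq n$ if for all $\mathcal{V}\subset\mathcal{U}$ with $|\mathcal{V}|>n+1$ one has $\bigcap\mathcal{V}=\emptyset$; $\operatorname{ord}\mathcal{U}=n$ if $\operatorname{ord}\mathcal{U}\leq n$ but not $\operatorname{ord}\mathcal{U}\leq n-1$. Let $\operatorname{mesh}(\mathcal{U})=\sup_{U\in\mathcal{U}}\operatorname{diam}(U)$. For $\epsilon>0$ and $Y\subset X$ compact define $$\dim_\epsilon Y=\inf\{\operatorname{ord}\mathcal{U}:\mathcal{U}\subset\tau,\ Y\subset\bigcup\mathcal{U},\ \operatorname{mesh}(\mathcal{U})<\epsilon\},$$ and $\dim Y=\lim_{\epsilon\to0}\dim_\epsilon Y$ (this is the usual topological dimension). $f$ is dw-expansive with central dimension $D\ge 0$ if there is $\sigma>0$ such that if $C\subset X$ is compact with $\dim(C)>D$ then there is $n\in\mathbb{Z}$ such that $\dim_\sigma(f^n(C))>D$. A set is non-trivial if it has more than one point. Given an integer $D\geq -1$, $f$ is partially expansive with central dimension $D$ if there is $\epsilon>0$ such that for every non-trivial compact set $C\subset X$ with $\dim(C)>D$ there is $k\in\mathbb{Z}$ with $\operatorname{diam}(f^k(C))\geq\epsilon$. *)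

(* Defs.v *)
From mathcomp Require Import all_boot all_order all_algebra.
From mathcomp Require Import all_classical all_reals all_analysis.

Set Implicit Arguments.
Unset Strict Implicit.
Unset Printing Implicit Defensive.

Import Order.TTheory GRing.Theory Num.Theory.

Local Open Scope classical_set_scope.
Local Open Scope ring_scope.

(* |V| > m for an integer m, where V may be infinite. *)
Definition card_gt (T : Type) (V : set T) (m : int) : Prop :=
  exists2 k : nat, m < k%:Z & (`I_k #<= V)%card.

Definition homeomorphism (X : topologicalType) (f : X -> X) : Prop :=
  exists g : X -> X,
    [/\ cancel f g, cancel g f, continuous f & continuous g].

(* The set f^n(C): for n = - k.+1 < 0 it is the preimage of C under the
   k.+1-st iterate, which for bijective f is the image under f^-(k.+1). *)
Definition iterz_image (X : Type) (f : X -> X) (n : int) (C : set X) : set X :=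
  match n with
  | Posz k => iter k f @` C
  | Negz k => iter k.+1 f @^-1` C
  end.

Definition nontrivial (X : Type) (C : set X) : Prop :=
  exists x y, [/\ C x, C y & x <> y].

Section dimension.
Context (R : realType) (X : metricType R).
Implicit Types (U V : set (set X)) (Y A : set X) (n : int) (eps : R).

(* Suprema of distances are taken in [0, +oo], so that diam and mesh of the
   empty set are 0 and not ereal_sup set0 = -oo. *)
Definition diam A : \bar R :=
  ereal_sup (0%E |` [set (mdist x y)%:E | x in A & y in A]).

Definition mesh U : \bar R := ereal_sup (0%E |` [set diam A | A in U]).

Definition ord_le U n : Prop :=
  forall V, V `<=` U -> card_gt V (n + 1) -> \bigcap_(A in V) A = set0.

(* The least n with ord_le U n, and +oo if there is none; see ord_eqP.  The
   intersection of the empty family is X, so n >= -1 is automatic when X is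
   nonempty; it is imposed to make ord total when X is empty. *)
Definition ord U : \bar R :=
  ereal_inf [set (n%:~R)%:E | n in [set n : int | -1 <= n /\ ord_le U n]].

Definition dim_eps Y eps : \bar R :=
  ereal_inf [set ord U | U in
    [set U | [/\ U `<=` open, Y `<=` \bigcup_(A in U) A
               & (mesh U < eps%:E)%E]]].

Definition dim Y : \bar R := lim (dim_eps Y eps @[eps --> 0^'+]).

Definition dw_expansive (f : X -> X) (D : int) : Prop :=
  exists2 sigma : R, 0 < sigma &
    forall C : set X, compact C -> ((D%:~R)%:E < dim C)%E ->
      exists n : int, ((D%:~R)%:E < dim_eps (iterz_image f n C) sigma)%E.

Definition partially_expansive (f : X -> X) (D : int) : Prop :=
  exists2 eps : R, 0 < eps &
    forall C : set X, nontrivial C -> compact C -> ((D%:~R)%:E < dim C)%E ->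
      exists k : int, (eps%:E <= diam (iterz_image f k C))%E.

Lemma ord_eqP U n : [set: X] !=set0 ->
  ord U = (n%:~R)%:E <-> ord_le U n /\ ~ ord_le U (n - 1).
Proof.
move=> [x _].
have lem1 m : ord_le U m -> -1 <= m.
  move=> Um; rewrite leNgt; apply/negP => m1.
  have : (\bigcap_(A in (set0 : set (set X))) A) x by [].
  rewrite Um //; exists 0%N; last by rewrite II0 card_ge0.
  by rewrite -ltrBrDr sub0r.
have lemW m p : m <= p -> ord_le U m -> ord_le U p.
  move=> mp Um V VU [k pk kV]; apply: Um => //; exists k => //.
  by apply: le_lt_trans pk; rewrite lerD2r.
split=> [ordn|[Un Un1]].
- have ge m : ord_le U m -> n <= m.
    move=> Um; rewrite -(ler_int R) -lee_fin -ordn.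
    by apply: ereal_inf_lbound; exists m => //; split=> //; exact: lem1.
  split; last by move=> /ge; rewrite lerBrDl gerDr ler10.
  have : (ord U < (n + 1)%:~R%:E)%E by rewrite ordn lte_fin ltr_int ltrDl.
  move=> /ereal_inf_lt[_ [m [_ Um] <-]]; rewrite lte_fin ltr_int ltzD1 => mn.
  exact: lemW mn Um.
- apply/eqP; rewrite eq_le; apply/andP; split.
    by apply: ereal_inf_lbound; exists n => //; split=> //; exact: lem1.
  apply: le_ereal_inf_tmp => _ [m [_ Um] <-]; rewrite lee_fin ler_int leNgt.
  apply/negP => mn; apply: Un1; apply: lemW Um.
  by rewrite lerBrDr lezD1.
Qed.

Lemma is_cvg_dim_eps Y : cvg (dim_eps Y eps @[eps --> 0^'+]).
Proof.
apply/cvg_ex; exists (ereal_sup (dim_eps Y @` `]0, 1[)).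
apply: nonincreasing_at_right_cvge; first by rewrite bnd_simp ltr01.
move=> a b _ _ ab; apply: ereal_inf_le_tmp => _ [U [Uo UY Ua] <-].
by exists U => //; split=> //; apply: lt_le_trans Ua _; rewrite lee_fin.
Qed.

End dimension.

(* Main.v *)
Require Import Defs.
From mathcomp Require Import all_boot all_order all_algebra.
From mathcomp Require Import all_classical all_reals all_analysis.
From mathcomp Require Import lra.

(** A compact set whose iterates all have small diameter cannot have an iterate
    of positive dimension at scale [sigma]: a set [A] of diameter less than
    [sigma / 4] lies in a single open set [U] of diameter less than [sigma],
    and the one-element cover [[set U]] has order at most 0, so that
    [dim_eps A sigma <= 0] (lemma [dim_eps_le0]).  Since [0 <= D], the iterate
    [f^n(C)] with [dim_sigma (f^n(C)) > D] provided by dw-expansivity must have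
    diameter at least [sigma / 4], and this is the constant of partial
    expansivity. *)

Import Order.TTheory GRing.Theory Num.Theory.

Local Open Scope classical_set_scope.
Local Open Scope ring_scope.

Lemma mdist_le_diam (R : realType) (X : metricType R) (A : set X) (x y : X) :
  A x -> A y -> ((mdist x y)%:E <= diam A)%E.
Proof. by move=> Ax Ay; apply: ereal_sup_ubound; right; exists x => //; exists y. Qed.

Lemma diam_le (R : realType) (X : metricType R) (A : set X) (r : R) :
  0 <= r -> (forall x y, A x -> A y -> mdist x y <= r) -> (diam A <= r%:E)%E.
Proof.
move=> r0 Ar; apply: ge_ereal_sup => _ [->|[x Ax [y Ay <-]]]; rewrite lee_fin //.
exact: Ar.
Qed.

Lemma mesh_set1 (R : realType) (X : metricType R) (U : set X) :
  mesh [set U] = diam U.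
Proof.
rewrite /mesh image_set1; apply/eqP; rewrite eq_le; apply/andP; split.
  by apply: ge_ereal_sup => _ [->|->//]; apply: ereal_sup_ubound; left.
by apply: ereal_sup_ubound; right.
Qed.

Lemma ord_set1_le0 (R : realType) (X : metricType R) (U : set X) :
  (ord [set U] <= 0 :> \bar R)%E.
Proof.
apply: ereal_inf_lbound; exists 0 => //; split => // V VU [k k1 kV].
have: (`I_k #<= `I_1)%card.
  apply: card_le_trans kV _; apply: card_le_trans (subset_card_le VU) _.
  by have /card_eqPle[] := @card_set1 _ U.
by rewrite card_le_II leqNgt; move: k1; rewrite add0r ltz_nat => ->.
Qed.

(** The open set is the [e]-neighbourhood of [A]; each of its points is
    [e]-close to [A], which costs at most [2 * e] in the diameter. *)
Lemma open_thickening (R : realType) (X : metricType R) (A : set X) (e : R) :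
  0 < e -> (diam A < e%:E)%E ->
  exists U, [/\ open U, A `<=` U & (diam U <= (3 * e)%:E)%E].
Proof.
move=> e0 Ae; exists (\bigcup_(x in A) (ball x e)°); split.
- by apply: bigcup_open => x _; exact: open_interior.
- by move=> x Ax; exists x => //; exact: nbhsx_ballx.
apply: diam_le => [|x y [a Aa /interior_subset] + [b Ab /interior_subset]].
  by rewrite mulr_ge0 // ltW.
rewrite !ballEmdist /= => ax yb.
have ab : mdist a b < e.
  by rewrite -lte_fin; apply: le_lt_trans Ae; exact: mdist_le_diam.
have := metric_triangle x a y; have := metric_triangle a b y.
rewrite (metric_sym x a); lra.
Qed.

Lemma dim_eps_le0 (R : realType) (X : metricType R) (A : set X) (sigma : R) :
  0 < sigma -> (diam A < (sigma / 4)%:E)%E -> (dim_eps A sigma <= 0)%E.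
Proof.
move=> s0 As; have [|U [oU AU dU]] := open_thickening _ _ A (sigma / 4) _ As.
  by rewrite divr_gt0.
apply: le_trans (ord_set1_le0 _ _ U); apply: ereal_inf_lbound.
exists [set U] => //; split; first by move=> _ ->.
  by rewrite bigcup_set1.
by rewrite mesh_set1; apply: le_lt_trans dU _; rewrite lte_fin; lra.
Qed.

Theorem proposition2p13 (R : realType) (X : metricType R) (f : X -> X) (D : int)
    (X_compact : compact [set: X]) (f_homeo : homeomorphism f) (D_ge0 : 0 <= D) :
  dw_expansive f D -> partially_expansive f D.
Proof.
move=> [sigma s0 fD]; exists (sigma / 4); first by rewrite divr_gt0.
move=> C _ cC /(fD C cC)[n Dn]; exists n.
rewrite leNgt; apply/negP => /(dim_eps_le0 _ _ _ _ s0).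
apply/negP; rewrite -ltNge; apply: le_lt_trans Dn.
by rewrite lee_fin ler0z.
Qed.
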